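(* Let $f$ satisfy $(\mathcal A)$, let $t_0>0$, $q>0$, $p\ge1$. Let $y:[t_0,+\infty[\to\mathcal H$ be continuously differentiable and $\lambda:[t_0,+\infty[\to\,]0,+\infty[$ continuous such that, with $\tau(t)=\frac{1}{q^q}\big(t_0+\int_{t_0}^t[\lambda(r)]^{1/q}dr\big)^q$, for all $t\ge t_0$: $$\dot y(t)+\dot\tau(t)\nabla f(y(t))=0,\qquad [\lambda(t)]^p\|\dot y(t)\|^{p-1}=1 .$$ Then, as $t\to+\infty$: (i) $f(y(t))-\inf_{\mathcal H}f=o\big(t^{-(1+q-\frac1p)}\big)$; (ii) $\|\nabla f(y(t))\|=o\big(t^{-(1+q-\frac1p)}\big)$; (iii) $\int_{t_0}^{+\infty}t^{1+\frac1q-\frac{1}{pq}}\|\dot y(t)\|^{2+\frac{p-1}{pq}}\,dt<+\infty$; (iv) $y(t)$ converges weakly as $t\to+\infty$ to an element of $S=\operatorname{argmin} f$.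
   Context: $\mathcal H$ is a real Hilbert space. Assumption $(\mathcal A)$: $f:\mathcal H\to\mathbb R$ is convex and continuously differentiable, $S=\operatorname{argmin}_{\mathcal H} f\neq\emptyset$, and $\nabla f$ is Lipschitz continuous on bounded subsets of $\mathcal H$. *)

(* Defs.v *)
From HB Require Import structures.
From mathcomp Require Import all_boot all_order all_algebra.
From mathcomp Require Import all_classical all_reals all_analysis.
Set Implicit Arguments. Unset Strict Implicit. Unset Printing Implicit Defensive.
Import Order.TTheory GRing.Theory Num.Theory.
Import numFieldNormedType.Exports.
Local Open Scope ring_scope.
Local Open Scope classical_set_scope.

Section Defs.
Variable R : realType.

(* A real Hilbert space is modelled as a complete normed R-module H together
   with an inner product inducing its norm. *)
Definition is_inner_product (H : normedModType R) (inner : H -> H -> R) : Prop :=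
  [/\ (forall x y, inner x y = inner y x),
      (forall (a : R) x y z, inner (a *: x + y) z = a * inner x z + inner y z)
    & (forall x, inner x x = `|x| ^+ 2)].

Definition is_gradient (H : normedModType R) (inner : H -> H -> R)
    (f : H -> R) (gradf : H -> H) : Prop :=
  forall x, differentiable f x /\ forall h, 'd f x h = inner (gradf x) h.

Definition convex_fun (H : normedModType R) (f : H -> R) : Prop :=
  forall (x y : H) (t : R), 0 <= t <= 1 ->
    f (t *: x + (1 - t) *: y) <= t * f x + (1 - t) * f y.

Definition lipschitz_on_bounded (H : normedModType R) (g : H -> H) : Prop :=
  forall M : R, exists L : R, forall x y : H, `|x| <= M -> `|y| <= M ->
    `|g x - g y| <= L * `|x - y|.

Definition argmin (H : normedModType R) (f : H -> R) : set H :=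
  [set x | forall z, f x <= f z].

(* Little-o as t -> +oo (literally the library's littleo_def). *)
Definition littleo_pinfty (u v : R -> R) : Prop :=
  forall eps : R, 0 < eps -> \forall t \near +oo, `|u t| <= eps * `|v t|.

Definition weak_cvg_pinfty (H : normedModType R) (inner : H -> H -> R)
    (y : R -> H) (x : H) : Prop :=
  forall z : H, (fun t => inner (y t) z) @ (pinfty_nbhs R) --> inner x z.

Definition tau (t0 q : R) (lam : R -> R) (t : R) : R :=
  (q `^ q)^-1 *
  (t0 + \int[(@lebesgue_measure R)]_(r in `[t0, t]) (lam r `^ q^-1)) `^ q.

End Defs.

(* Main.v *)
Require Import Defs.
From HB Require Import structures.
From mathcomp Require Import all_boot all_order all_algebra.
From mathcomp Require Import all_classical all_reals all_analysis.
From mathcomp Require Import ring lra measurable_realfun.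
Set Implicit Arguments. Unset Strict Implicit.
Import Order.TTheory GRing.Theory Num.Theory.
Import numFieldNormedType.Exports.
Local Open Scope ring_scope.
Local Open Scope classical_set_scope.

(** Since [y' = - tau' gradf(y)], the curve [y] is a gradient flow run in the time
    [tau]. Along it [E = tau (f(y) - min f) + |y - x*|^2 / 2] satisfies
    [E' <= - tau tau' |gradf(y)|^2]; both [f(y)] and [|gradf(y)|] are
    nonincreasing, so the convergence of [|y - x*|^2] and of [E] gives
    [tau (f(y) - min f) -> 0] and [tau |gradf(y)| -> 0], and Opial's lemma gives
    the weak limit. It remains to bound [tau] from below. With
    [L = t0 + int lam^(1/q)], [tau] is proportional to [L^q], and the closed-loop
    relation turns the dissipation [tau tau' |gradf(y)|^2] into
    [L |y'|^(2 + (p-1)/(pq)) / q]; for [p > 1] this is [L u^(-a) / q] with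
    [u = L'] and [a > 1]. Its integrability forces
    [L >= c t^(1 + 1/q - 1/(pq))], whence the rates and the integral estimate. *)

(** * Derivatives of curves as limits of difference quotients *)

Lemma cvg_is_derive (R : realType) (V : normedModType R) (f : R -> V) (t : R)
    (df : V) :
  h^-1 *: (f (h + t) - f t) @[h --> 0^'] --> df -> is_derive t 1 f df.
Proof.
move=> cf.
have E : (fun h => h^-1 *: (f (h + t) - f t)) =
    (fun h => h^-1 *: ((f \o shift t) (h *: (1 : R)) - f t)).
  by apply/funext => h /=; rewrite /GRing.scale /= mulr1.
rewrite E in cf.
split; last exact: (@cvg_lim _ _ _ _ _ _ _ cf).
by rewrite /derivable; apply/cvg_ex; exists df.
Qed.

Lemma is_derive_cvg (R : realType) (V : normedModType R) (f : R -> V) (t : R)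
    (df : V) :
  is_derive t 1 f df -> h^-1 *: (f (h + t) - f t) @[h --> 0^'] --> df.
Proof.
move=> [dtf <-].
have E : (fun h => h^-1 *: (f (h + t) - f t)) =
    (fun h => h^-1 *: ((f \o shift t) (h *: (1 : R)) - f t)).
  by apply/funext => h /=; rewrite /GRing.scale /= mulr1.
by rewrite E; exact: dtf.
Qed.

Lemma is_derive_continuous (R : realType) (V : normedModType R) (f : R -> V)
    (t : R) (df : V) :
  is_derive t 1 f df -> {for t, continuous f}.
Proof.
by move=> [dtf _]; apply: differentiable_continuous; apply/derivable1_diffP.
Qed.

(** * Inner product identities, continuity and derivatives *)

Section InnerProduct.
Variables (R : realType) (H : normedModType R) (inner : H -> H -> R).
Hypothesis ip : is_inner_product inner.

Lemma innerC x y : inner x y = inner y x.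
Proof. by case: ip => /(_ x y). Qed.

Lemma innerxx x : inner x x = `|x| ^+ 2.
Proof. by case: ip => _ _ /(_ x). Qed.

Lemma innerDl x y z : inner (x + y) z = inner x z + inner y z.
Proof. by case: ip => _ /(_ 1 x y z) + _; rewrite scale1r mul1r. Qed.

Lemma inner0l z : inner 0 z = 0.
Proof. by have := innerDl 0 0 z; rewrite addr0; lra. Qed.

Lemma innerZl a x z : inner (a *: x) z = a * inner x z.
Proof. by case: ip => _ /(_ a x 0 z) + _; rewrite addr0 inner0l addr0. Qed.

Lemma innerNl x z : inner (- x) z = - inner x z.
Proof. by rewrite -scaleN1r innerZl mulN1r. Qed.

Lemma innerBl x y z : inner (x - y) z = inner x z - inner y z.
Proof. by rewrite innerDl innerNl. Qed.

Lemma innerDr x y z : inner z (x + y) = inner z x + inner z y.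
Proof. by rewrite innerC innerDl !(innerC _ z). Qed.

Lemma innerZr a x z : inner z (a *: x) = a * inner z x.
Proof. by rewrite innerC innerZl innerC. Qed.

Lemma innerNr x z : inner z (- x) = - inner z x.
Proof. by rewrite innerC innerNl innerC. Qed.

Lemma innerBr x y z : inner z (x - y) = inner z x - inner z y.
Proof. by rewrite innerDr innerNr. Qed.

Lemma normD_sqr x y : `|x + y| ^+ 2 = `|x| ^+ 2 + 2 * inner x y + `|y| ^+ 2.
Proof. by rewrite -!innerxx innerDl !innerDr (innerC y x); ring. Qed.

Lemma normB_sqr x y : `|x - y| ^+ 2 = `|x| ^+ 2 - 2 * inner x y + `|y| ^+ 2.
Proof. by rewrite normD_sqr innerNr normrN; ring. Qed.

Lemma inner_polarization x y :
  inner x y = 4^-1 * (`|x + y| ^+ 2 - `|x - y| ^+ 2).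
Proof. by rewrite normB_sqr normD_sqr; field. Qed.

Lemma inner_le_norm x y : inner x y <= `|x| * `|y|.
Proof.
have := ler_normD x y; rewrite -ler_sqr ?nnegrE ?addr_ge0// normD_sqr sqrrD.
lra.
Qed.

Lemma norm_inner_le x y : `|inner x y| <= `|x| * `|y|.
Proof.
rewrite ler_norml inner_le_norm andbT lerNl -innerNl.
by rewrite (le_trans (inner_le_norm _ _))// normrN.
Qed.

(** Polarization reduces joint continuity of [inner] to continuity of the norm. *)
Lemma cvg_inner (T : Type) (F : set_system T) {FF : Filter F} (u v : T -> H)
    (a b : H) :
  u @ F --> a -> v @ F --> b -> inner (u t) (v t) @[t --> F] --> inner a b.
Proof.
move=> ua vb; rewrite inner_polarization.
under eq_cvg do rewrite inner_polarization.
apply: cvgM; first exact: cvg_cst.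
apply: cvgB; rewrite expr2; under eq_cvg do rewrite expr2.
- by apply: cvgM; apply: cvg_norm; apply: cvgD.
- by apply: cvgM; apply: cvg_norm; apply: cvgB.
Qed.

(** The product rule: [inner (y t) (w (h + t))] is subtracted and added in the difference
    quotient. *)
Lemma is_derive_inner (y w : R -> H) (t : R) (dy dw : H) :
  is_derive t 1 y dy -> is_derive t 1 w dw ->
  is_derive t 1 (fun s => inner (y s) (w s)) (inner dy (w t) + inner (y t) dw).
Proof.
move=> dty dtw; apply: cvg_is_derive.
under eq_cvg => h.
  have -> : h^-1 *: (inner (y (h + t)) (w (h + t)) - inner (y t) (w t)) =
      inner (h^-1 *: (y (h + t) - y t)) (w (h + t)) +
      inner (y t) (h^-1 *: (w (h + t) - w t)).
    by rewrite innerZl innerZr innerBl innerBr /GRing.scale /=; ring.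
  over.
apply: cvgD; apply: cvg_inner.
- exact: is_derive_cvg.
- apply: (@cvg_comp _ _ _ (fun h => h + t) w 0^' (nbhs t)); last first.
    exact: is_derive_continuous dtw.
  apply: cvg_within_filter; rewrite -{2}[t]add0r.
  by apply: cvgD; [exact: cvg_id|exact: cvg_cst].
- exact: cvg_cst.
- exact: is_derive_cvg.
Qed.

Lemma is_derive_innerl (y : R -> H) (z : H) (t : R) (dy : H) :
  is_derive t 1 y dy -> is_derive t 1 (fun s => inner (y s) z) (inner dy z).
Proof.
move=> dty; have := is_derive_inner dty (is_derive_cst z t 1).
by rewrite (innerC _ 0) inner0l addr0.
Qed.

Lemma is_derive_half_norm_sqr (y : R -> H) (x : H) (t : R) (dy : H) :
  is_derive t 1 y dy ->
  is_derive t 1 (fun s => 2^-1 * `|y s - x| ^+ 2) (inner (y t - x) dy).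
Proof.
move=> dty; have dB := is_deriveB dty (is_derive_cst x t 1).
rewrite (_ : (fun _ => _) =
    2^-1 \*: (fun s => inner ((y - cst x) s) ((y - cst x) s))); last first.
  by apply/funext => s /=; rewrite innerxx.
apply: (is_derive_eq (is_deriveZ 2^-1 (is_derive_inner dB dB))).
rewrite subr0 (innerC dy) /GRing.scale /=.
have -> : (y - cst x) t = y t - x by [].
by field.
Qed.

End InnerProduct.

(** * Riesz representation, weak compactness and Opial's lemma *)

Section Weak.
Variables (R : realType) (H : completeNormedModType R) (inner : H -> H -> R).
Hypothesis ip : is_inner_product inner.

(* The minimiser of [|x|^2 - 2 l x] represents [l]; minimising filters are
   Cauchy by the parallelogram identity. *)
Lemma riesz_representation (l : H -> R) (M : R) :
  (forall x y, l (x + y) = l x + l y) -> (forall a x, l (a *: x) = a * l x) ->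
  (forall x, `|l x| <= M * `|x|) -> exists x, forall z, l z = inner x z.
Proof.
move=> lD lZ lM.
pose J x := `|x| ^+ 2 - 2 * l x.
have Jlb : lbound (range J) (- M ^+ 2).
  move=> _ [x _ <-]; rewrite /J.
  have := lM x; rewrite ler_norml => /andP[_ lx].
  have := sqr_ge0 (`|x| - M); rewrite sqrrB; lra.
have Jinf : has_inf (range J) by split; [exists (J 0), 0|exists (- M ^+ 2)].
pose i := inf (range J).
have iJ x : i <= J x by apply: ge_inf; [exists (- M ^+ 2)|exists x].
pose F := filter_from [set e : R | 0 < e] (fun e => [set x | J x < i + e]).
have FF : ProperFilter F.
  apply: filter_from_proper.
    apply: filter_from_filter; first by exists 1 => /=.
    move=> a b /= a0 b0; exists (Num.min a b); first by rewrite /= lt_min a0.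
    by move=> x /= h; split; apply: (lt_le_trans h);
      rewrite lerD2l ge_min lexx ?orbT.
  move=> e /= e0; have [_ [x _ <-] h] := inf_adherent e0 Jinf.
  by exists x.
have Fe e : 0 < e -> F [set x | J x < i + e] by move=> e0; exists e.
have Jpar x z : `|x - z| ^+ 2 = 2 * (J x + J z - 2 * J (2^-1 *: (x + z))).
  rewrite /J lZ lD normrZ exprMn (normB_sqr ip) (normD_sqr ip) ger0_norm; last lra.
  by field.
have /cauchy_cvgP/cvg_ex[x /= Fx] : cauchy F.
  apply/cauchy_exP => e e0.
  (* If [J x] and [J z] are both below [i + d], then [Jpar] and [i <= J] at the midpoint give
     [|x - z|^2 < 4 d]; hence [d = e^2 / 4]. *)
  have d0 : 0 < e ^+ 2 / 4 by rewrite divr_gt0// exprn_gt0.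
  have [x Jx] := filter_ex (Fe _ d0).
  exists x; apply: filterS (Fe _ d0) => z /= Jz.
  rewrite -ball_normE /ball_ /= -ltr_sqr ?nnegrE ?(ltW e0)// Jpar.
  have := iJ (2^-1 *: (x + z)); move: Jx; rewrite /=; lra.
exists x => z.
(* The first variation of [J] at [x], obtained as a limit along [F]: [J w < i + e] and
   [i <= J (w + s *: z)] give it at [w] up to the error [e]. *)
have var s : 0 <= 2 * s * (inner x z - l z) + s ^+ 2 * `|z| ^+ 2.
  apply/ler_addgt0Pr => e e0; rewrite addrC.
  have cF : 2 * s * (inner w z - l z) + s ^+ 2 * `|z| ^+ 2 + e @[w --> F] -->
      2 * s * (inner x z - l z) + s ^+ 2 * `|z| ^+ 2 + e.
    apply: cvgD; last exact: cvg_cst.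
    apply: cvgD; last exact: cvg_cst.
    apply: cvgM; first exact: cvg_cst.
    apply: cvgB; last exact: cvg_cst.
    by apply: cvg_inner => //; exact: cvg_cst.
  rewrite addrC; apply: (cvgr_to_ge cF).
  apply: filterS (Fe _ e0) => w /= Jw.
  have := iJ (w + s *: z); move: Jw.
  rewrite /J lD lZ (normD_sqr ip) (innerZr ip) normrZ exprMn real_normK ?num_real//.
  lra.
have [z0|z0] := eqVneq (`|z| ^+ 2) 0.
  have := var (l z - inner x z); rewrite z0 mulr0 addr0 => h.
  apply/eqP; rewrite -subr_eq0 -sqrf_eq0; apply/eqP/le_anti.
  by rewrite sqr_ge0 andbT expr2; lra.
have zp : 0 < `|z| ^+ 2 by rewrite lt_neqAle eq_sym z0 sqr_ge0.
(* This [s] minimises the quadratic in [var], leaving minus a square over [|z|^2]. *)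
have := var ((l z - inner x z) / `|z| ^+ 2).
rewrite (_ : _ + _ = - ((l z - inner x z) ^+ 2 / `|z| ^+ 2)); last first.
  by field; rewrite sqrf_eq0 in z0.
rewrite oppr_ge0 pmulr_lle0 ?invr_gt0// => h.
apply/eqP; rewrite -subr_eq0 -sqrf_eq0; apply/eqP/le_anti.
by rewrite sqr_ge0 andbT.
Qed.

(** Weak compactness of balls: each scalar [inner (y t) z] stays in a compact segment, so it
    converges along the ultrafilter. The limit is linear and bounded in [z], and Riesz represents
    it. *)
Lemma bounded_weak_ultra_cvg (T : Type) (U : set_system T) (y : T -> H) (M : R) :
  UltraFilter U -> (\forall t \near U, `|y t| <= M) ->
  exists x, forall z, inner (y t) z @[t --> U] --> inner x z.
Proof.
move=> UU yM.
have cvgz z : exists a : R, inner (y t) z @[t --> U] --> a.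
  (* The image of an ultrafilter under a map is an ultrafilter. *)
  have UP : UltraFilter (inner (y t) z @[t --> U]).
    split; first exact: fmap_proper_filter.
    move=> G GG UG; apply/funext => A; apply/propext; split; last exact: UG.
    move=> GA.
    have [//|h] := in_ultra_setVsetC ((fun t => inner (y t) z) @^-1` A) UU.
    have : G (A `&` ~` A) by apply: filterI => //; apply: UG.
    by rewrite setICr => /filter_not_empty.
  have := @segment_compact R (- (M * `|z|)) (M * `|z|).
  rewrite compact_ultra => /(_ _ UP)[]; last by move=> a [_ ha]; exists a.
  apply: filterS yM => t yM /=; rewrite in_itv /= -ler_norml.
  by rewrite (le_trans (norm_inner_le ip _ _))// ler_wpM2r.
pose l z := projT1 (cid (cvgz z)).
have lE z : inner (y t) z @[t --> U] --> l z := projT2 (cid (cvgz z)).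
have [|||x xE] := @riesz_representation l M.
- move=> a b.
  have lab : inner (y t) (a + b) @[t --> U] --> l a + l b.
    by under eq_cvg do rewrite (innerDr ip); apply: cvgD.
  exact: (cvg_unique _ (lE _) lab).
- move=> k a.
  have lka : inner (y t) (k *: a) @[t --> U] --> k * l a.
    by under eq_cvg do rewrite (innerZr ip); apply: cvgM => //; exact: cvg_cst.
  exact: (cvg_unique _ (lE _) lka).
- move=> z; apply: (cvgr_to_le (cvg_norm (lE z))).
  apply: filterS yM => t yM.
  by rewrite (le_trans (norm_inner_le ip _ _))// ler_wpM2r.
by exists x => z; rewrite -xE.
Qed.

(* Two ultrafilter limits [a], [b] in [S] agree because
   [|y - a|^2 - |y - b|^2] converges and is affine in [y]. *)
Lemma opial (T : Type) (F : set_system T) (S : set H) (y : T -> H) (M : R) :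
  ProperFilter F -> (\forall t \near F, `|y t| <= M) ->
  (forall x, S x -> cvg (`|y t - x| ^+ 2 @[t --> F])) ->
  (forall U x, UltraFilter U -> F `<=` U ->
    (forall z, inner (y t) z @[t --> U] --> inner x z) -> S x) ->
  exists2 x, S x & forall z, inner (y t) z @[t --> F] --> inner x z.
Proof.
move=> FF yM cvS clS.
have wl U : UltraFilter U -> F `<=` U -> exists2 x, S x &
    forall z, inner (y t) z @[t --> U] --> inner x z.
  move=> UU FU; have [x xU] := bounded_weak_ultra_cvg UU (FU _ yM).
  by exists x => //; exact: (clS U).
have [U0 [UU0 FU0]] := ultraFilterLemma FF.
have [a Sa aU] := wl _ UU0 FU0.
exists a => // z; apply/cvgrPdist_lt => e e0; apply: contrapT => nF.
(* Failure of convergence at [z] makes [B] meet every set of [F]. An ultrafilter [V] finer than [F]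
   then contains [B]; its weak limit [b] will be shown equal to [a], which contradicts [B]. *)
pose B := [set t | ~ (`|inner a z - inner (y t) z| < e)].
have FB : ProperFilter (within B F).
  apply: Build_ProperFilter_ex => P; rewrite /within /= => PB.
  apply: contrapT => nP; apply: nF.
  apply: filterS PB => t PB; apply: contrapT => nB; apply: nP.
  by exists t; exact: PB.
have [V [UV FBV]] := ultraFilterLemma FB.
have FV : F `<=` V by move=> A FA; apply: FBV; exact: filterS FA.
have [b Sb bV] := wl _ UV FV.
have [/cvg_ex[la ala] /cvg_ex[lb blb]] := (cvS _ Sa, cvS _ Sb).
have aff : inner (y t) (b - a) @[t --> F] -->
    2^-1 * (la - lb - `|a| ^+ 2 + `|b| ^+ 2).
  under eq_cvg => t.
    have -> : inner (y t) (b - a) = 2^-1 *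
        (`|y t - a| ^+ 2 - `|y t - b| ^+ 2 - `|a| ^+ 2 + `|b| ^+ 2).
      by rewrite !(normB_sqr ip) (innerBr ip); field.
    over.
  apply: cvgM; first exact: cvg_cst.
  by apply: cvgD; last exact: cvg_cst; apply: cvgB; last exact: cvg_cst;
    apply: cvgB.
(* The limit [aff] along [F] is inherited by both [U0] and [V]. *)
have eqab : inner a (b - a) = inner b (b - a).
  rewrite (cvg_unique _ (aU (b - a)) (cvg_trans (cvg_app _ FU0) aff)) //.
  by rewrite (cvg_unique _ (bV (b - a)) (cvg_trans (cvg_app _ FV) aff)).
have ba : b = a.
  apply/eqP; rewrite -subr_eq0 -normr_eq0 -sqrf_eq0 -(innerxx ip).
  by rewrite (innerBl ip) -eqab subrr.
rewrite ba in bV.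
have VB : V B by apply: FBV; rewrite /within /=; exact: filterE.
have /cvgrPdist_lt/(_ e e0) bz := bV z.
by have [t [hB /hB]] := filter_ex (filterI VB bz).
Qed.

End Weak.

(** * Monotonicity criteria for real functions *)

Section RealFunctions.
Variable R : realType.
Implicit Types (phi dphi tau : R -> R).

Lemma derive_le0_le phi dphi (s t : R) : s <= t ->
  (forall r, s <= r <= t -> is_derive r 1 phi (dphi r)) ->
  (forall r, s <= r <= t -> dphi r <= 0) -> phi t <= phi s.
Proof.
move=> st dp dp0.
have [||c] := @MVT_segment R phi dphi s t st.
- by move=> x /andP[/ltW sx /ltW xt]; apply: dp; rewrite sx.
- apply: continuous_in_subspaceT => x; rewrite inE /= in_itv /= => xst.
  exact: is_derive_continuous (dp _ xst).
rewrite in_itv /= => cst E.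
by rewrite -subr_le0 E mulr_le0_ge0// ?dp0// subr_ge0.
Qed.

Lemma nonincreasing_pinfty_cvg phi (t0 : R) :
  (forall s t, t0 < s -> s <= t -> phi t <= phi s) ->
  (forall t, t0 < t -> 0 <= phi t) ->
  exists2 l, phi @ +oo --> l & forall t, t0 < t -> l <= phi t.
Proof.
move=> phid phi0.
pose A := phi @` [set t | t0 < t].
have hA : has_inf A.
  split; first by exists (phi (t0 + 1)), (t0 + 1) => //=; rewrite ltrDl.
  by exists 0 => _ [t /= t0t <-]; exact: phi0.
have lA t : t0 < t -> inf A <= phi t.
  by move=> t0t; apply: ge_inf; [exact: hA.2|exists t].
exists (inf A) => //; apply/cvgrPdist_lt => e e0.
have [_ [s /= t0s <-] se] := inf_adherent e0 hA.
near=> t.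
have st : s <= t by near: t; apply: nbhs_pinfty_ge; exact: num_real.
have lt := lA _ (lt_le_trans t0s st).
rewrite distrC ger0_norm ?subr_ge0//.
by rewrite ltrBlDl (le_lt_trans _ se)// phid.
Unshelve. all: by end_near. Qed.

(* Bisecting [[a, b]] at the midpoint of the values of [tau] halves the bound. *)
Lemma le_of_sqr_increment phi tau (s C : R) :
  (forall t, s <= t -> {for t, continuous tau}) ->
  (forall a b, s <= a -> a <= b -> tau a <= tau b) ->
  (forall a b, s <= a -> a <= b -> phi b - phi a <= C * (tau b - tau a) ^+ 2) ->
  forall a b, s <= a -> a <= b -> phi b <= phi a.
Proof.
move=> ctau mtau phiC.
have bis n : forall a b, s <= a -> a <= b ->
    2 ^+ n * (phi b - phi a) <= C * (tau b - tau a) ^+ 2.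
  elim: n => [|n IH] a b sa ab; first by rewrite mul1r; exact: phiC.
  have tab := mtau _ _ sa ab.
  have [||c] := @IVT R tau a b (2^-1 * (tau a + tau b)) ab.
  - apply: continuous_in_subspaceT => x; rewrite inE /= in_itv /= => /andP[ax _].
    by apply: ctau; exact: le_trans ax.
  - by rewrite minEle maxEle tab; apply/andP; split; lra.
  rewrite in_itv /= => /andP[ac cb] tc.
  have h1 := IH _ _ sa ac; have h2 := IH _ _ (le_trans sa ac) cb.
  move: h1 h2; rewrite tc (exprS 2 n).
  set x := tau a; set z := tau b.
  have -> : (2^-1 * (x + z) - x) ^+ 2 = 4^-1 * (z - x) ^+ 2 by field.
  have -> : (z - 2^-1 * (x + z)) ^+ 2 = 4^-1 * (z - x) ^+ 2 by field.
  lra.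
move=> a b sa ab; rewrite leNgt; apply/negP => h.
have d0 : 0 < phi b - phi a by rewrite subr_gt0.
set K := C * (tau b - tau a) ^+ 2.
(* With [K / (phi b - phi a) < n < 2^n], the bound after [n] bisections is violated. *)
have := archi_boundP (normr_ge0 (K / (phi b - phi a))).
set n := Num.bound _ => nK.
have := bis n _ _ sa ab; rewrite leNgt => /negP; apply.
rewrite -/K -ltr_pdivrMr// (le_lt_trans (ler_norm _))// (lt_trans nK)//.
by rewrite -natrX ltr_nat ltn_expl.
Qed.

End RealFunctions.

(** * Chain rule and first-order inequalities for a convex function *)

Section ConvexGradient.
Variables (R : realType) (H : normedModType R) (inner : H -> H -> R).
Variables (f : H -> R) (gradf : H -> H).
Hypotheses (ip : is_inner_product inner) (fgrad : is_gradient inner f gradf).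

Lemma is_derive_comp_gradient (y : R -> H) (t : R) (dy : H) :
  is_derive t 1 y dy ->
  is_derive t 1 (fun s => f (y s)) (inner (gradf (y t)) dy).
Proof.
move=> [dty <-]; have [df dfE] := fgrad (y t).
have dify : differentiable y t by apply/derivable1_diffP.
have difc : differentiable (f \o y) t by exact: differentiable_comp.
split; first by apply/derivable1_diffP.
rewrite -[LHS]/('D_1 (f \o y) t) deriveE// diff_comp//=.
by rewrite dfE -(deriveE _ dify).
Qed.

Hypothesis fconv : convex_fun f.

(** For [0 < h <= 1] convexity bounds the difference quotient in the direction [z - x] by
    [f z - f x]; let [h] tend to 0 from the right. *)
Lemma convex_gradient_le x z : f x + inner (gradf x) (z - x) <= f z.
Proof.
have [df dfE] := fgrad x.
rewrite -dfE -deriveE// addrC -lerBrDr.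
have /cvg_dnbhs_at_right dc : h^-1 *: ((f \o shift x) (h *: (z - x)) - f x)
    @[h --> 0^'] --> 'D_(z - x) f x by exact: diff_derivable.
apply: (cvgr_to_le dc); near=> h.
have h0 : 0 < h by near: h; exact: nbhs_right_gt.
have h1 : h <= 1 by near: h; exact: nbhs_right_le.
rewrite /= /GRing.scale /= ler_pdivrMl//.
have -> : h *: (z - x) + x = h *: z + (1 - h) *: x.
  by rewrite scalerBr scalerBl scale1r addrAC addrA.
have := @fconv z x h; rewrite (ltW h0) h1 => /(_ isT); lra.
Unshelve. all: by end_near. Qed.

Lemma gradient_monotone x z : 0 <= inner (gradf x - gradf z) (x - z).
Proof.
have := convex_gradient_le x z; have := convex_gradient_le z x.
rewrite !(innerBr ip) !(innerBl ip); lra.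
Qed.

End ConvexGradient.

(** * Lyapunov analysis of the gradient flow in the time [tau] *)

Section GradientFlow.
Variables (R : realType) (H : completeNormedModType R) (inner : H -> H -> R).
Variables (f : H -> R) (gradf : H -> H) (xs : H).
Variables (t0 : R) (tau dtau : R -> R) (y : R -> H).
Hypotheses (ip : is_inner_product inner) (fconv : convex_fun f).
Hypotheses (fgrad : is_gradient inner f gradf) (xsmin : argmin f xs).
Hypothesis glip : lipschitz_on_bounded gradf.
Hypothesis dtauE : forall t, t0 < t -> is_derive t 1 tau (dtau t).
Hypothesis dtau_gt0 : forall t, t0 < t -> 0 < dtau t.
Hypothesis tau_gt0 : forall t, t0 < t -> 0 < tau t.
Hypothesis flow : forall t, t0 < t ->
  is_derive t 1 y (- dtau t *: gradf (y t)).

Local Notation g t := (gradf (y t)).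

Definition energy t := tau t * (f (y t) - f xs) + 2^-1 * `|y t - xs| ^+ 2.

(** The derivative of [energy] along the flow, grouped so that convexity makes the first term
    nonpositive. *)
Definition denergy t :=
  dtau t * (f (y t) - f xs - inner (g t) (y t - xs))
  - tau t * dtau t * `|g t| ^+ 2.

Lemma energy_ge0 t : t0 < t -> 0 <= energy t.
Proof.
move=> t0t; rewrite addr_ge0// ?mulr_ge0 ?sqr_ge0 ?(ltW (tau_gt0 t0t))//.
by rewrite subr_ge0.
Qed.

Lemma is_derive_value t : t0 < t ->
  is_derive t 1 (fun s => f (y s)) (- dtau t * `|g t| ^+ 2).
Proof.
move=> /flow fl; apply: (is_derive_eq (is_derive_comp_gradient fgrad fl)).
by rewrite (innerZr ip) (innerxx ip).
Qed.

Lemma is_derive_dist x t : t0 < t ->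
  is_derive t 1 (fun s => 2^-1 * `|y s - x| ^+ 2)
    (- dtau t * inner (g t) (y t - x)).
Proof.
move=> /flow fl; apply: (is_derive_eq (is_derive_half_norm_sqr ip x fl)).
by rewrite (innerZr ip) (innerC ip).
Qed.

Lemma is_derive_energy t : t0 < t -> is_derive t 1 energy (denergy t).
Proof.
move=> t0t; have dv := is_derive_value t0t.
have dB := is_deriveB dv (is_derive_cst (f xs) t 1).
have dM := is_deriveM (dtauE t0t) dB.
apply: (is_derive_eq (is_deriveD dM (is_derive_dist xs t0t))).
rewrite /denergy /GRing.scale /= subr0.
have -> : ((fun s => f (y s)) - cst (f xs)) t = f (y t) - f xs by [].
by ring.
Qed.

Lemma denergy_le t : t0 < t -> denergy t <= - (tau t * dtau t * `|g t| ^+ 2).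
Proof.
move=> t0t; rewrite /denergy gerDr pmulr_rle0 ?dtau_gt0//.
have := convex_gradient_le fgrad fconv (y t) xs.
by rewrite -(opprB (y t)) (innerNr ip); lra.
Qed.

Lemma energy_nonincreasing s t : t0 < s -> s <= t -> energy t <= energy s.
Proof.
move=> t0s st; apply: (@derive_le0_le _ energy denergy) => // r /andP[sr _];
  have t0r := lt_le_trans t0s sr; first exact: is_derive_energy.
apply: (le_trans (denergy_le t0r)).
by rewrite oppr_le0 mulr_ge0 ?sqr_ge0// mulr_ge0// ltW ?tau_gt0 ?dtau_gt0.
Qed.

Lemma value_nonincreasing s t : t0 < s -> s <= t -> f (y t) <= f (y s).
Proof.
move=> t0s st; apply: (@derive_le0_le _ (fun r => f (y r))
    (fun r => - dtau r * `|g r| ^+ 2)) => // r /andP[sr _];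
  have t0r := lt_le_trans t0s sr; first exact: is_derive_value.
by rewrite mulNr oppr_le0 mulr_ge0 ?sqr_ge0// ltW ?dtau_gt0.
Qed.

Lemma tau_nondecreasing s t : t0 < s -> s <= t -> tau s <= tau t.
Proof.
move=> t0s st; rewrite -lerN2.
apply: (@derive_le0_le _ (- tau) (- dtau)) => // r /andP[sr _];
  have t0r := lt_le_trans t0s sr.
  exact: is_deriveN (dtauE t0r).
by rewrite oppr_le0 ltW ?dtau_gt0.
Qed.

(** With the final value frozen, [|y - x|^2 / 2 + (f (y t) - f x) tau] is nonincreasing on [[s, t]],
    by convexity and the decrease of [f] along [y]. *)
Lemma value_gap_le x s t : argmin f x -> t0 < s -> s <= t ->
  (tau t - tau s) * (f (y t) - f x) <=
  2^-1 * `|y s - x| ^+ 2 - 2^-1 * `|y t - x| ^+ 2.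
Proof.
move=> xmin t0s st.
have : 2^-1 * `|y t - x| ^+ 2 + (f (y t) - f x) * tau t <=
       2^-1 * `|y s - x| ^+ 2 + (f (y t) - f x) * tau s.
  apply: (@derive_le0_le _ (fun r => 2^-1 * `|y r - x| ^+ 2
      + (f (y t) - f x) * tau r)
    (fun r => - dtau r * inner (g r) (y r - x) + (f (y t) - f x) * dtau r))
    => // r /andP[sr rt]; have t0r := lt_le_trans t0s sr.
    exact: is_deriveD (is_derive_dist x t0r) (is_deriveZ _ (dtauE t0r)).
  rewrite (_ : _ + _ =
    dtau r * (f (y t) - f x - inner (g r) (y r - x))); last by ring.
  rewrite pmulr_rle0 ?dtau_gt0//.
  have := convex_gradient_le fgrad fconv (y r) x.
  rewrite -(opprB (y r)) (innerNr ip).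
  have := value_nonincreasing t0r rt; lra.
lra.
Qed.

Lemma dist_nonincreasing x s t : argmin f x -> t0 < s -> s <= t ->
  `|y t - x| ^+ 2 <= `|y s - x| ^+ 2.
Proof.
move=> xmin t0s st; have := value_gap_le xmin t0s st.
have : 0 <= (tau t - tau s) * (f (y t) - f x).
  by rewrite mulr_ge0 ?subr_ge0// tau_nondecreasing.
lra.
Qed.

Lemma norm_flow_le s t : t0 < s -> s <= t -> `|y t| <= `|xs| + `|y s - xs|.
Proof.
move=> t0s st; rewrite -[y t](subrK xs) addrC (le_trans (ler_normD _ _))//.
rewrite lerD2l -ler_sqr ?nnegrE//; exact: dist_nonincreasing.
Qed.

(** The decreasing distance to [xs] confines the flow after [s] to the ball of radius [M], where
    [glip] supplies both constants. *)
Lemma gradient_lipschitz_flow s : t0 < s -> exists L G : R,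
  [/\ 0 <= L, 0 <= G,
    (forall a b, s <= a -> s <= b -> `|g a - g b| <= L * `|y a - y b|) &
    (forall a, s <= a -> `|g a| <= G)].
Proof.
move=> t0s; set M := `|xs| + `|y s - xs|.
have xsM : `|xs| <= M by rewrite lerDl.
have [L0 hL0] := glip M.
(* The constant taken from [glip] could be negative. *)
pose L := Num.max L0 0.
have hL x z : `|x| <= M -> `|z| <= M -> `|gradf x - gradf z| <= L * `|x - z|.
  move=> xM zM; apply: (le_trans (hL0 _ _ xM zM)).
  by rewrite ler_wpM2r// le_max lexx.
have L0' : 0 <= L by rewrite le_max lexx orbT.
exists L, (`|gradf xs| + L * `|y s - xs|); split=> //.
- by rewrite addr_ge0// mulr_ge0.
- by move=> a b sa sb; apply: hL; exact: norm_flow_le.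
move=> a sa; rewrite -[g a](subrK (gradf xs)) addrC.
rewrite (le_trans (ler_normD _ _))// lerD2l.
rewrite (le_trans (hL _ _ (norm_flow_le t0s sa) xsM))// ler_wpM2l//.
by rewrite -ler_sqr ?nnegrE// dist_nonincreasing.
Qed.

(* Monotonicity of the gradient along the chord from [y a] to [y b] bounds the
   increment of [|g|^2] by a multiple of [(tau b - tau a)^2]. *)
Lemma gradient_norm_nonincreasing s t : t0 < s -> s <= t -> `|g t| <= `|g s|.
Proof.
move=> t0s st; have [L [G [L0 G0 gL gG]]] := gradient_lipschitz_flow t0s.
have gts r : s <= r -> t0 < r by exact: lt_le_trans.
have mt a b : s <= a -> a <= b -> tau a <= tau b.
  by move=> sa; apply: tau_nondecreasing; exact: gts.
(* [y] is [G]-Lipschitz in the time [tau]. The mean value argument is run on the scalar function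
   [inner (y r) w]. *)
have yL a b : s <= a -> a <= b -> `|y b - y a| <= G * (tau b - tau a).
  move=> sa ab; set w := y b - y a.
  have [->|w0] := eqVneq w 0.
    by rewrite normr0 mulr_ge0// subr_ge0 mt.
  have w1 : 0 < `|w| by rewrite normr_gt0.
  have : inner (y b) w - G * `|w| * tau b <= inner (y a) w - G * `|w| * tau a.
    apply: (@derive_le0_le _ (fun r => inner (y r) w - G * `|w| * tau r)
      (fun r => inner (- dtau r *: g r) w - G * `|w| * dtau r))
      => // r /andP[ar _]; have sr := le_trans sa ar; have t0r := gts _ sr.
      exact: is_deriveB (is_derive_innerl ip w (flow t0r))
                        (is_deriveZ _ (dtauE t0r)).
    rewrite (innerZl ip) (_ : _ - _ = - dtau r * (inner (g r) w + G * `|w|));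
      last by ring.
    rewrite mulNr oppr_le0 pmulr_rge0 ?dtau_gt0//.
    have := norm_inner_le ip (g r) w; rewrite ler_norml => /andP[+ _].
    have := ler_wpM2r (ltW w1) (gG _ sr); lra.
  have -> : inner (y b) w - G * `|w| * tau b <= inner (y a) w - G * `|w| * tau a
      = (inner w w <= G * (tau b - tau a) * `|w|).
    by rewrite {3}/w (innerBl ip); apply/idP/idP; lra.
  by rewrite (innerxx ip) expr2 ler_pM2r.
rewrite -ler_sqr ?nnegrE//.
apply: (@le_of_sqr_increment _ (fun r => `|g r| ^+ 2) tau s (2 * (L * G) ^+ 2))
  => //.
  by move=> r sr; exact: is_derive_continuous (dtauE (gts _ sr)).
move=> a b sa ab; set D := tau b - tau a.
have sb := le_trans sa ab.
have [->|ab'] := eqVneq a b.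
  by rewrite subrr mulr_ge0 ?sqr_ge0// mulr_ge0 ?sqr_ge0.
have D0 : 0 <= D by rewrite subr_ge0 mt.
set w := g b - g a.
have gD r : a <= r -> r <= b -> `|g b - g r| <= L * G * D.
  move=> ar rb; have sr := le_trans sa ar.
  apply: (le_trans (gL _ _ sb sr)); rewrite -mulrA ler_wpM2l//.
  apply: (le_trans (yL _ _ sr rb)); rewrite ler_wpM2l//.
  by rewrite lerB// mt.
have wD : `|w| <= L * G * D by exact: gD.
(* Over [[a, b]] the velocity in the time [tau] is [- g r], within [L G D] of [- g b]; this
   estimates [inner (y b - y a) w] from above. *)
have : inner (y b) w + (inner (g b) w - L * G * D * `|w|) * tau b <=
       inner (y a) w + (inner (g b) w - L * G * D * `|w|) * tau a.
  apply: (@derive_le0_le _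
    (fun r => inner (y r) w + (inner (g b) w - L * G * D * `|w|) * tau r)
    (fun r => inner (- dtau r *: g r) w
      + (inner (g b) w - L * G * D * `|w|) * dtau r))
    => // r /andP[ar rb]; have sr := le_trans sa ar; have t0r := gts _ sr.
    exact: is_deriveD (is_derive_innerl ip w (flow t0r))
                      (is_deriveZ _ (dtauE t0r)).
  rewrite (innerZl ip) (_ : _ + _ = dtau r *
    (inner (g b) w - inner (g r) w - L * G * D * `|w|)); last by ring.
  rewrite pmulr_rle0 ?dtau_gt0//.
  have := inner_le_norm ip (g b - g r) w; rewrite (innerBl ip).
  have := ler_wpM2r (normr_ge0 w) (gD _ ar rb); lra.
(* Monotonicity gives [inner (y b - y a) w >= 0]. With the previous estimate, dividing by [D > 0]
   yields [inner (g b) w <= L G D |w| <= (L G D)^2]. *)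
have mono := gradient_monotone ip fgrad fconv (y b) (y a).
rewrite -/w (innerC ip) (innerBl ip) in mono.
have D1 : D = 0 -> w = 0.
  by move=> D1; apply/eqP; rewrite -normr_le0 (le_trans wD)// D1 mulr0.
have phiE : `|g b| ^+ 2 - `|g a| ^+ 2 = 2 * inner (g b) w - `|w| ^+ 2.
  have -> : g a = g b - w by rewrite /w opprB addrC subrK.
  by rewrite (normB_sqr ip); ring.
rewrite phiE => key.
have [DE|Dn] := eqVneq D 0.
  by rewrite (D1 DE) (innerC ip) (inner0l ip) normr0 DE; lra.
have Dp : 0 < D by rewrite lt_neqAle eq_sym Dn.
have : D * (inner (g b) w - L * G * D * `|w|) <= 0.
  by move: key; set K := _ - _ * `|w|; rewrite /D; lra.
rewrite pmulr_rle0// => kk.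
have h1 : L * G * D * `|w| <= L * G * D * (L * G * D).
  by rewrite ler_wpM2l// !mulr_ge0.
have := sqr_ge0 `|w|; lra.
Qed.

(** The same freezing device: [energy + |g t|^2 tau^2 / 2] is nonincreasing on [[s, t]], because
    [|g r| >= |g t|] and [tau^2 / 2] has derivative [tau tau']. *)
Lemma gradient_gap_le s t : t0 < s -> s <= t ->
  2^-1 * (tau t ^+ 2 - tau s ^+ 2) * `|g t| ^+ 2 <= energy s - energy t.
Proof.
move=> t0s st.
have : energy t + (2^-1 * `|g t| ^+ 2) * tau t ^+ 2 <=
       energy s + (2^-1 * `|g t| ^+ 2) * tau s ^+ 2.
  apply: (@derive_le0_le _
    (fun r => energy r + (2^-1 * `|g t| ^+ 2) * tau r ^+ 2)
    (fun r => denergy r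
      + (2^-1 * `|g t| ^+ 2) * (2%:R * tau r ^+ 1 * dtau r)))
    => // r /andP[sr rt]; have t0r := lt_le_trans t0s sr.
    exact: is_deriveD (is_derive_energy t0r)
                      (is_deriveZ _ (is_deriveX 2 (dtauE t0r))).
  have := denergy_le t0r.
  have : `|g t| ^+ 2 <= `|g r| ^+ 2.
    by rewrite ler_sqr ?nnegrE// gradient_norm_nonincreasing.
  have P : 0 <= tau r * dtau r by rewrite ltW// mulr_gt0 ?tau_gt0 ?dtau_gt0.
  move=> /(ler_wpM2l P); rewrite expr1; lra.
lra.
Qed.

Hypothesis tau_pinfty : tau @ +oo --> +oo.

Lemma tau_near_ge (A : R) : \forall t \near +oo, A <= tau t.
Proof. by have /cvgryPge/(_ A) := tau_pinfty. Qed.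

Lemma tau_value_small e : 0 < e ->
  \forall t \near +oo, tau t * (f (y t) - f xs) <= e.
Proof.
move=> e0.
have [||l hl hle] := @nonincreasing_pinfty_cvg R
    (fun t => 2^-1 * `|y t - xs| ^+ 2) t0.
- by move=> s t t0s st; rewrite ler_pM2l ?invr_gt0// dist_nonincreasing.
- by move=> t _; rewrite mulr_ge0 ?sqr_ge0.
(* Once the half squared distance at [s] is within [e / 2] of its limit, [(tau t - tau s) (f (y t) -
   f xs) <= e / 2]; [2 tau s <= tau t] then doubles the bound. *)
have e2 : 0 < e / 2 by lra.
have /cvgrPdist_lt/(_ _ e2) hs := hl.
have [s [/= hs1 t0s]] := filter_ex (filterI hs (nbhs_pinfty_gt (num_real t0))).
move: hs1; rewrite ltr_norml => /andP[hs1 _].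
near=> t.
have st : s <= t by near: t; apply: nbhs_pinfty_ge; exact: num_real.
have tt : 2 * tau s <= tau t by near: t; exact: tau_near_ge.
have := value_gap_le xsmin t0s st; have := hle _ (lt_le_trans t0s st).
have F0 : 0 <= f (y t) - f xs by rewrite subr_ge0.
have := ler_wpM2r F0 tt; lra.
Unshelve. all: by end_near. Qed.

Lemma tau_gradient_small e : 0 < e ->
  \forall t \near +oo, tau t * `|g t| <= e.
Proof.
move=> e0.
have [l hl hle] := nonincreasing_pinfty_cvg energy_nonincreasing energy_ge0.
(* From [2 tau s <= tau t] one gets [(tau t^2 - tau s^2) / 2 >= 3/8 tau t^2]. *)
have e2 : 0 < 3 / 8 * e ^+ 2 by rewrite mulr_gt0 ?exprn_gt0//; lra.
have /cvgrPdist_lt/(_ _ e2) hs := hl.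
have [s [/= hs1 t0s]] := filter_ex (filterI hs (nbhs_pinfty_gt (num_real t0))).
move: hs1; rewrite ltr_norml => /andP[hs1 _].
near=> t.
have st : s <= t by near: t; apply: nbhs_pinfty_ge; exact: num_real.
have tt : 2 * tau s <= tau t by near: t; exact: tau_near_ge.
have t0t := lt_le_trans t0s st.
have ts0 := ltW (tau_gt0 t0s); have tt0 := ltW (tau_gt0 t0t).
rewrite -ler_sqr ?nnegrE ?(ltW e0) ?mulr_ge0//.
have := gradient_gap_le t0s st; have := hle _ t0t.
have : (2 * tau s) ^+ 2 <= tau t ^+ 2 by rewrite ler_sqr ?nnegrE ?mulr_ge0.
move=> /(ler_wpM2r (sqr_ge0 `|g t|)).
rewrite !exprMn; lra.
Unshelve. all: by end_near. Qed.

Lemma flow_weak_cvg :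
  exists2 x, argmin f x & forall z, inner (y t) z @[t --> +oo] --> inner x z.
Proof.
have t01 : t0 < t0 + 1 by rewrite ltrDl.
apply: (@opial _ _ _ ip _ _ (argmin f) y (`|xs| + `|y (t0 + 1) - xs|)).
- apply: filterS (nbhs_pinfty_ge (num_real (t0 + 1))) => t.
  exact: norm_flow_le.
- move=> x xmin.
  have [||l hl _] := @nonincreasing_pinfty_cvg R (fun t => `|y t - x| ^+ 2) t0.
  + by move=> s t; exact: dist_nonincreasing.
  + by move=> t _; exact: sqr_ge0.
  by apply/cvg_ex; exists l.
(* Weak limit points are minimisers: the tangent inequality [f x + inner (gradf x) (y t - x) <= f (y
   t)] passes to the weak limit, its left side being affine in [y t]. *)
move=> U x UU FU xU; suff xxs : f x <= f xs.
  by move=> z; apply: (le_trans xxs); exact: xsmin.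
apply/ler_addgt0Pr => e e0.
have cU : f x + (inner (y t) (gradf x) - inner (gradf x) x) @[t --> U] --> f x.
  rewrite -[X in _ --> X]addr0 -(subrr (inner (gradf x) x)) {2}(innerC ip).
  apply: cvgD; first exact: cvg_cst.
  by apply: cvgB; [exact: xU|exact: cvg_cst].
apply: (cvgr_to_le cU); apply: FU; near=> t.
rewrite (innerC ip) -(innerBr ip).
apply: (le_trans (convex_gradient_le fgrad fconv _ _)).
have h1 : tau t * (f (y t) - f xs) <= e.
  by near: t; exact: tau_value_small.
have h2 : 1 <= tau t by near: t; exact: tau_near_ge.
have F0 : 0 <= f (y t) - f xs by rewrite subr_ge0.
have := ler_wpM2r F0 h2; lra.
Unshelve. all: by end_near. Qed.

End GradientFlow.

(** * The time change [tau] and the growth of the clock *)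

Lemma powR_continuous (R : realType) (a x : R) :
  0 < x -> {for x, continuous (fun z : R => z `^ a)}.
Proof. by move=> x0; exact: is_derive_continuous (is_derive1_powR a x0). Qed.

Section TimeChange.
Variables (R : realType) (t0 q : R) (lam : R -> R).
Hypotheses (t0_gt0 : 0 < t0) (q_gt0 : 0 < q).
Hypothesis lam_cont : {within `[t0, +oo[, continuous lam}.
Hypothesis lam_gt0 : forall t, t0 <= t -> 0 < lam t.

(** The [u] of the overview, derivative of [clock]. *)
Definition rate t := lam t `^ q^-1.

(** The [L] of the overview, so that [tau] is [clock^q / q^q]. *)
Definition clock t :=
  t0 + \int[(@lebesgue_measure R)]_(r in `[t0, t]) (lam r `^ q^-1).

Definition dtau t := (q `^ q)^-1 * (q * clock t `^ (q - 1) * rate t).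

Lemma rate_gt0 t : t0 <= t -> 0 < rate t.
Proof. by move=> t0t; rewrite powR_gt0 ?lam_gt0. Qed.

Lemma rate_within_continuous : {within `[t0, +oo[, continuous rate}.
Proof.
apply: (@within_continuous_comp _ _ _ `[t0, +oo[ lam (fun z : R => z `^ q^-1)) => //.
move=> _ /set_mem[t /= + <-]; rewrite in_itv /= andbT => t0t.
by apply: powR_continuous; exact: lam_gt0.
Qed.

Lemma rate_continuous t : t0 < t -> {for t, continuous rate}.
Proof.
move=> t0t; have /continuous_within_itvcyP[+ _] := rate_within_continuous.
by apply; rewrite in_itv /= t0t.
Qed.

Lemma clock_ge t : t0 <= clock t.
Proof. by rewrite lerDl Rintegral_ge0// => r _; exact: powR_ge0. Qed.

Lemma clock_gt0 t : 0 < clock t.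
Proof. exact: lt_le_trans (clock_ge t). Qed.

Lemma is_derive_clock t : t0 < t -> is_derive t 1 clock (rate t).
Proof.
move=> t0t.
have [||||d1 d2] := @continuous_FTC1 R rate (BLeft t0) t (t + 1).
- by rewrite ltrDl.
- apply: continuous_compact_integrable; first exact: segment_compact.
  apply: continuous_subspaceW rate_within_continuous => r /=.
  by rewrite !in_itv /= => /andP[->].
- by rewrite lte_fin.
- exact: rate_continuous.
have d3 := derivableP d1; rewrite -derive1E d2 in d3.
have := is_deriveD (is_derive_cst t0 t 1) d3.
by rewrite add0r.
Qed.

Lemma is_derive_clock_powR a t : t0 < t ->
  is_derive t 1 (fun s => clock s `^ a) (a * clock t `^ (a - 1) * rate t).
Proof.
move=> t0t.
exact: is_derive1_comp (is_derive1_powR a (clock_gt0 t)) (is_derive_clock t0t).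
Qed.

Lemma is_derive_tau t : t0 < t -> is_derive t 1 (tau t0 q lam) (dtau t).
Proof.
by move=> t0t; exact: (is_deriveZ _ (is_derive_clock_powR q t0t)).
Qed.

Lemma dtau_gt0 t : t0 <= t -> 0 < dtau t.
Proof.
move=> t0t; rewrite /dtau !mulr_gt0 ?invr_gt0 ?powR_gt0 ?clock_gt0//.
exact: lam_gt0.
Qed.

Lemma tau_gt0 t : 0 < tau t0 q lam t.
Proof. by rewrite mulr_gt0 ?invr_gt0 ?powR_gt0 ?clock_gt0. Qed.

(** The logarithmic derivative [tau' / tau = q u / L] in product form. With [|y'| = tau' |g|] it
    turns [q tau tau' |g|^2] into [L |y'|^2 / u]. *)
Lemma tau_dtau t : tau t0 q lam t * (q * rate t) = clock t * dtau t.
Proof.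
rewrite /tau /dtau -/(clock t) -(mulr_powRB1 (ltW (clock_gt0 t)) q_gt0); ring.
Qed.

Lemma dtau_continuous t : t0 < t -> {for t, continuous dtau}.
Proof.
move=> t0t; rewrite /dtau /continuous_at.
apply: cvgM; first exact: cvg_cst.
apply: cvgM; last exact: rate_continuous.
apply: cvgM; first exact: cvg_cst.
exact: is_derive_continuous (is_derive_clock_powR _ t0t).
Qed.

Lemma tau_ge_powR (c k : R) t : 0 <= c -> c * t `^ k <= clock t ->
  (q `^ q)^-1 * c `^ q * t `^ (k * q) <= tau t0 q lam t.
Proof.
move=> c0 ct; rewrite -mulrA ler_pM2l ?invr_gt0 ?powR_gt0//.
rewrite powRrM -powRM ?powR_ge0// ge0_ler_powR ?nnegrE ?(ltW q_gt0)//.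
  by rewrite mulr_ge0 ?powR_ge0.
exact: ltW (clock_gt0 t).
Qed.

(* With [eps] proportional to [t], integrating
   [1 <= eps L u^(-1/al) + eps^(-al) L^(-al) u] (one of the two terms is at
   least 1) against the dissipation bound yields the growth of [L = clock]. *)
Lemma clock_growth (E dE : R -> R) (al k : R) :
  0 < al < 1 -> k * (1 - al) = 1 + al ->
  (forall t, t0 < t -> is_derive t 1 E (dE t)) ->
  (forall t, t0 < t -> 0 <= E t) ->
  (forall t, t0 < t -> clock t * rate t `^ (- al^-1) <= - (q * dE t)) ->
  exists c T : R, [/\ 0 < c, t0 < T & forall t, T <= t -> c * t `^ k <= clock t].
Proof.
move=> /andP[al0 al1] kal dEE E0 dEle.
pose s := t0 + 1; have t0s : t0 < s by rewrite ltrDl.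
have s0 : 0 < s by exact: lt_trans t0s.
(* [q * E s] bounds the dissipation integrated from [s] on; the [+ 1] makes the constant
   positive. *)
pose C0 := q * E s + 1.
have C0p : 0 < C0 by rewrite ltr_wpDl// mulr_ge0 ?E0// ltW.
pose b := 1 - al; have b0 : 0 < b by rewrite subr_gt0.
pose c1 := (4 * C0) `^ (- al) * (b / 4).
have c1p : 0 < c1 by rewrite mulr_gt0 ?powR_gt0 ?divr_gt0// mulr_gt0.
exists (c1 `^ b^-1), (2 * s); split; first exact: powR_gt0.
  by lra.
move=> t st; have ts : s < t by lra.
have tp : 0 < t by lra.
have t2 : t <= 2 * (t - s) by lra.
have tq : t / 4 <= (t - s) / 2 by lra.
(* With this [eps] the dissipation term accounts for at most half of [t - s]. *)
have [eps epsp epsE] : exists2 eps, 0 < eps & eps * (2 * C0) = t - s.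
  exists ((t - s) / (2 * C0)); first by rewrite divr_gt0 ?subr_gt0 ?mulr_gt0.
  by rewrite divfK// gt_eqF// mulr_gt0.
have point r : t0 < r ->
    1 <= eps * (clock r * rate r `^ (- al^-1))
         + eps `^ (- al) * (clock r `^ (- al) * rate r).
  move=> t0r; have u0 := rate_gt0 (ltW t0r); have L0 := clock_gt0 r.
  have A0 : 0 <= eps * (clock r * rate r `^ (- al^-1)).
    by rewrite ltW// mulr_gt0// mulr_gt0// powR_gt0.
  have B0 : 0 <= eps `^ (- al) * (clock r `^ (- al) * rate r).
    by rewrite ltW// mulr_gt0 ?powR_gt0// mulr_gt0// powR_gt0.
  (* The first term is at least 1 when [u^(1/al) <= eps L], the second otherwise. *)
  have [h|h] := lerP (rate r `^ al^-1) (eps * clock r).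
    apply: le_trans (_ : _ <= eps * (clock r * rate r `^ (- al^-1))) _.
      by rewrite powRN mulrA ler_pdivlMr ?mul1r// powR_gt0.
    by rewrite lerDl.
  apply: le_trans (_ : _ <= eps `^ (- al) * (clock r `^ (- al) * rate r)) _.
    rewrite mulrA -powRM ?(ltW epsp) ?(ltW L0)// powRN mulrC.
    rewrite ler_pdivlMr ?mul1r; last by rewrite powR_gt0// mulr_gt0.
    rewrite -[leRHS](powRr1 (ltW u0)) -(mulVf (lt0r_neq0 al0)) powRrM.
    rewrite ge0_ler_powR ?nnegrE ?powR_ge0 ?(ltW al0)// ?(ltW h)//.
    by rewrite mulr_ge0 ?ltW.
  by rewrite lerDr.
pose K := eps `^ (- al) / b.
have Kp : 0 < K by rewrite divr_gt0 ?powR_gt0.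
(* Integrated form of [point], stated as the decrease of one function: [L^b] has derivative
   [b L^(-al) u]. *)
have mono : t + eps * q * E t - K * clock t `^ b <=
            s + eps * q * E s - K * clock s `^ b.
  apply: (@derive_le0_le _ (fun r => r + eps * q * E r - K * clock r `^ b)
    (fun r => 1 + eps * q * dE r - K * (b * clock r `^ (b - 1) * rate r)));
    first exact: ltW.
    move=> r /andP[sr _]; have t0r := lt_le_trans t0s sr.
    apply: is_deriveB; last exact: is_deriveZ (is_derive_clock_powR _ t0r).
    exact: is_deriveD (is_derive_id r 1) (is_deriveZ _ (dEE _ t0r)).
  move=> r /andP[sr _]; have t0r := lt_le_trans t0s sr.
  have -> : K * (b * clock r `^ (b - 1) * rate r) =
      eps `^ (- al) * (clock r `^ (- al) * rate r).
    have -> : b - 1 = - al by rewrite /b; lra.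
    by rewrite /K; field; exact: lt0r_neq0.
  have := point _ t0r; have := ler_wpM2l (ltW epsp) (dEle _ t0r); lra.
have arith (a c x1 x2 x3 x4 : R) : a + x1 - x3 <= c + x2 - x4 ->
    0 <= x1 -> 0 <= x4 -> x2 <= (a - c) / 2 -> (a - c) / 2 <= x3.
  by clear; lra.
have main : (t - s) / 2 <= K * clock t `^ b.
  have h1 : 0 <= eps * q * E t.
    by rewrite !mulr_ge0 ?E0 ?ltW//; exact: lt_trans ts.
  have h2 : 0 <= K * clock s `^ b by rewrite mulr_ge0 ?powR_ge0 ?ltW.
  have h3 : eps * q * E s <= (t - s) / 2.
    have -> : (t - s) / 2 = eps * C0 by rewrite -epsE; field.
    by rewrite -mulrA ler_pM2l// lerDl.
  exact: (arith _ _ _ _ _ _ mono h1 h2 h3).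
(* Since [t >= 2 s], [eps >= t / (4 C0)]; inserted in [main], where [K = eps^(-al) / b], this leaves
   only powers of [t]. *)
have bnd : c1 * t `^ (1 + al) <= clock t `^ b.
  have h1 : (t / (4 * C0)) `^ al <= eps `^ al.
    apply: ge0_ler_powR; rewrite ?nnegrE ?(ltW al0) ?(ltW epsp)//.
      by rewrite divr_ge0 ?mulr_ge0 ?ltW.
    rewrite ler_pdivrMr ?mulr_gt0//.
    rewrite (_ : _ * (4 * C0) = 2 * (t - s)); first exact: t2.
    by rewrite -epsE; ring.
  have h2 := le_trans tq main.
  have h3 : eps `^ al * (t / 4) * b <= clock t `^ b.
    have ea : 0 < eps `^ al by exact: powR_gt0.
    have eb : 0 <= eps `^ al * b by rewrite mulr_ge0// ltW.
    have := ler_wpM2l eb h2.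
    rewrite [leRHS](_ : _ = clock t `^ b).
      by rewrite [leLHS](_ : _ = eps `^ al * (t / 4) * b) //; ring.
    rewrite /K powRN mulrA mulrACA mulfV ?gt_eqF// mulfV ?gt_eqF//.
    by rewrite !mul1r.
  apply: le_trans h3.
  rewrite powRD; last by rewrite gt_eqF// ltr_wpDr ?ltW.
  rewrite powRr1 ?(ltW tp)// /c1 powRN.
  have C4 : 0 <= 4 * C0 by rewrite mulr_ge0 ?(ltW C0p).
  have tE : (t / (4 * C0)) `^ al = t `^ al * ((4 * C0) `^ al)^-1.
    rewrite [LHS]powRM ?(ltW tp) ?invr_ge0//; congr (_ * _).
    by rewrite -[in RHS]powRN -(powR_inv1 C4) -powRrM mulN1r.
  move: h1; rewrite tE.
  have q0 : 0 <= t / 4 * b by rewrite mulr_ge0 ?divr_ge0 ?ltW.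
  move=> /(ler_wpM2r q0) h.
  rewrite [leRHS](_ : _ = eps `^ al * (t / 4 * b)); last by ring.
  rewrite [leLHS](_ : _ = t `^ al * ((4 * C0) `^ al)^-1 * (t / 4 * b)) //.
  by ring.
(* Take the power [1 / b] of [bnd]; the relation on [k] says [k = (1 + al) / b]. *)
have -> : c1 `^ b^-1 * t `^ k = (c1 * t `^ (1 + al)) `^ b^-1.
  rewrite powRM ?powR_ge0 ?(ltW c1p)// -powRrM -kal mulfK//.
  exact: lt0r_neq0.
have cE : clock t = (clock t `^ b) `^ b^-1.
  by rewrite -powRrM mulfV ?gt_eqF// powRr1// ltW// clock_gt0.
rewrite [leRHS]cE.
have X0 : 0 <= c1 * t `^ (1 + al).
  by apply: mulr_ge0; [exact: ltW|exact: powR_ge0].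
have b1 : 0 <= b^-1 by rewrite invr_ge0 ltW.
by apply: ge0_ler_powR => //; rewrite nnegrE// powR_ge0.
Qed.

End TimeChange.

(** * Integrability from dissipation and the closed-loop exponent *)

(** Before [T] the integrand is bounded on a bounded interval; after [T] it is dominated by [- dG],
    whose integral is finite because [G] decreases to a limit. *)
Lemma integral_dissipation_lty (R : realType) (w G dG : R -> R) (t0 T K : R) :
  t0 <= T -> measurable_fun `[t0, +oo[ w -> (forall t, t0 <= t -> 0 <= w t) ->
  (forall t, t0 <= t <= T -> w t <= K) ->
  (forall t, T <= t -> is_derive t 1 G (dG t)) ->
  (forall t, T <= t -> {for t, continuous dG}) ->
  (forall t, T <= t -> 0 <= G t) -> (forall t, T <= t -> w t <= - dG t) ->
  (\int[(@lebesgue_measure R)]_(t in `[t0, +oo[) (w t)%:E < +oo)%E.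
Proof.
move=> t0T mw w0 wK dGE dGc G0 wdG.
have dG0 t : T <= t -> 0 <= - dG t.
  by move=> Tt; apply: le_trans (wdG _ Tt); apply: w0; exact: le_trans Tt.
have [||l Gl _] := @nonincreasing_pinfty_cvg R G T.
- move=> s t Ts st; apply: (@derive_le0_le _ G dG) => // r /andP[sr _];
    have Tr := le_trans (ltW Ts) sr; first exact: dGE.
  by rewrite -oppr_ge0 dG0.
- by move=> t /ltW; exact: G0.
have splitE : `[t0, +oo[ = `[t0, T[ `|` `[T, +oo[ :> set R.
  apply/seteqP; split=> x /=; rewrite !in_itv /= !andbT.
    by move=> t0x; have [Tx|xT] := leP T x; [right|left; rewrite t0x].
  by case=> [/andP[]//|]; exact: le_trans.
rewrite splitE ge0_integral_setU//; last 3 first.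
- by rewrite -splitE; apply/measurable_EFinP.
- rewrite -splitE => t /=; rewrite in_itv /= andbT => t0t.
  by rewrite lee_fin w0.
- apply/disj_setPS => t [] /=; rewrite !in_itv /= andbT => /andP[_ tT].
  by rewrite leNgt tT.
have mS (A : set R) : A `<=` `[t0, +oo[ -> measurable_fun A (fun t => (w t)%:E).
  by move=> /measurable_funS; apply => //; exact/measurable_EFinP.
have sub1 : `[t0, T[ `<=` `[t0, +oo[ by rewrite splitE; exact: subsetUl.
have sub2 : `[T, +oo[ `<=` `[t0, +oo[ by rewrite splitE; exact: subsetUr.
apply: lte_add_pinfty.
- apply: (@le_lt_trans _ _
      (\int[(@lebesgue_measure R)]_(t in `[t0, T[) (cst K%:E t))%E).
    apply: ge0_le_integral => //.
    + by move=> t /sub1 /=; rewrite in_itv /= andbT => t0t; rewrite lee_fin w0.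
    + exact: mS.
    + move=> t /=; rewrite in_itv /= => /andP[t0t tT].
      by rewrite lee_fin wK// t0t ltW.
  rewrite integral_cst//= lebesgue_measure_itv /=.
  by case: ifP => _; rewrite ?mule0 ?ltry// -EFinB -EFinM ltry.
have mdG : measurable_fun `[T, +oo[ (fun t => - dG t).
  apply: subspace_continuous_measurable_fun => //.
  apply: continuous_in_subspaceT => t; rewrite inE /= in_itv /= andbT => Tt.
  by apply: cvgN; exact: dGc.
apply: (@le_lt_trans _ _
    (\int[(@lebesgue_measure R)]_(t in `[T, +oo[) (- dG t)%:E)%E).
  apply: ge0_le_integral => //.
  + by move=> t /sub2 /=; rewrite in_itv /= andbT => t0t; rewrite lee_fin w0.
  + exact: mS.
  + exact/measurable_EFinP.
  + by move=> t /=; rewrite in_itv /= andbT => Tt; rewrite lee_fin wdG.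
have NGE t : T <= t -> is_derive t 1 (fun s => - G s) (- dG t).
  by move=> Tt; exact: is_deriveN (dGE _ Tt).
(* [- G] is a primitive with limit [- l], so the tail integral is [G T - l]. *)
rewrite (@ge0_continuous_FTC2y R (fun t => - dG t) (fun t => - G t) T (- l)).
- by rewrite -EFinB ltry.
- exact: dG0.
- apply: continuous_in_subspaceT => t; rewrite inE /= in_itv /= andbT => Tt.
  by apply: cvgN; exact: dGc.
- exact: cvgN.
- by move=> t /ltW /NGE [].
- apply: cvg_within_filter; apply: is_derive_continuous (NGE _ _).
  exact: lexx.
- move=> t; rewrite in_itv /= andbT => /ltW /NGE [_ <-].
  by rewrite derive1E.
Qed.

(** Raise the closed-loop relation to the power [1 / (p q)]. *)
Lemma speed_rate (R : realType) (p q l n : R) : 0 < q -> 1 <= p -> 0 < l ->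
  0 <= n -> l `^ p * n `^ (p - 1) = 1 ->
  n `^ ((p - 1) / (p * q)) = (l `^ q^-1)^-1.
Proof.
move=> q0 p1 l0 n0 E.
have p0 : 0 < p by exact: lt_le_trans p1.
have : (l `^ p * n `^ (p - 1)) `^ (p * q)^-1 = 1 by rewrite E powR1.
rewrite powRM ?powR_ge0// -!powRrM.
have -> : p * (p * q)^-1 = q^-1.
  by field; rewrite (gt_eqF p0) (gt_eqF q0).
move=> h; apply: (mulfI (lt0r_neq0 (powR_gt0 q^-1 l0))).
by rewrite h mulfV// lt0r_neq0// powR_gt0.
Qed.

Lemma argmin_inf (R : realType) (H : normedModType R) (f : H -> R) (x : H) :
  argmin f x -> inf (range f) = f x.
Proof.
move=> xmin; apply/le_anti/andP; split.
  by apply: ge_inf; [exists (f x) => _ [z _ <-]; exact: xmin|exists x].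
by apply: lb_le_inf; [exists (f x), x|move=> _ [z _ <-]; exact: xmin].
Qed.

(** * The closed-loop system: decay rates, integral estimate, weak limit *)

Unset Implicit Arguments.

Theorem mainTheorem3 (R : realType) (H : completeNormedModType R)
  (inner : H -> H -> R) (f : H -> R) (gradf : H -> H)
  (t0 q p : R) (y ydot : R -> H) (lam : R -> R) :
  (* H is a real Hilbert space *)
  is_inner_product inner ->
  (* assumption (A) *)
  convex_fun f ->
  is_gradient inner f gradf ->
  continuous gradf ->
  argmin f !=set0 ->
  lipschitz_on_bounded gradf ->
  (* parameters *)
  0 < t0 -> 0 < q -> 1 <= p ->
  (* y is continuously differentiable on [t0, +oo[ with derivative ydot
     (one-sided at t0) *)
  (forall t, t0 < t -> is_derive t 1 y (ydot t)) ->
  (fun h => h^-1 *: (y (h + t0) - y t0)) @ 0^'+ --> ydot t0 ->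
  {within `[t0, +oo[, continuous ydot} ->
  (* lambda : [t0, +oo[ -> ]0, +oo[ continuous *)
  {within `[t0, +oo[, continuous lam} ->
  (forall t, t0 <= t -> 0 < lam t) ->
  (* the system *)
  (forall t, t0 < t -> ydot t + derive1 (tau t0 q lam) t *: gradf (y t) = 0) ->
  (forall t, t0 <= t -> lam t `^ p * `|ydot t| `^ (p - 1) = 1) ->
  [/\ littleo_pinfty (fun t => f (y t) - inf (range f))
        (fun t => t `^ (- (1 + q - p^-1))),
      littleo_pinfty (fun t => `|gradf (y t)|)
        (fun t => t `^ (- (1 + q - p^-1))),
      (\int[(@lebesgue_measure R)]_(t in `[t0, +oo[)
          ((t `^ (1 + q^-1 - (p * q)^-1)) *
           (`|ydot t| `^ (2 + (p - 1) / (p * q))))%:E < +oo)%E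
    & exists2 x, argmin f x & weak_cvg_pinfty inner y x].
Proof.
move=> ip fconv fgrad gcont [xs xsmin] glip t0p qp p1 dy _ ydotc lamc lamp sys eqn.
have pp : 0 < p by exact: lt_le_trans p1.
have u0 t : t0 < t -> 0 < rate q lam t by move=> /ltW; exact: rate_gt0.
have dtauE := is_derive_tau q t0p lamc lamp.
have dtp t : t0 < t -> 0 < dtau t0 q lam t.
  by move=> /ltW; exact: dtau_gt0.
have taup t : t0 < t -> 0 < tau t0 q lam t by move=> _; exact: tau_gt0.
have ydotE t : t0 < t -> ydot t = - dtau t0 q lam t *: gradf (y t).
  move=> t0t; have [_ dE] := dtauE _ t0t.
  have /eqP := sys _ t0t; rewrite derive1E dE addr_eq0 => /eqP ->.
  by rewrite scaleNr.
have flow t : t0 < t -> is_derive t 1 y (- dtau t0 q lam t *: gradf (y t)).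
  by move=> t0t; rewrite -ydotE//; exact: dy.
pose E := energy f xs (tau t0 q lam) y.
pose dE := denergy inner f gradf xs (tau t0 q lam) (dtau t0 q lam) y.
have dEE t : t0 < t -> is_derive t 1 E (dE t).
  exact: is_derive_energy.
have E0 t : t0 < t -> 0 <= E t by exact: energy_ge0.
pose e := (p - 1) / (p * q).
have spd t : t0 <= t -> `|ydot t| `^ e = (rate q lam t)^-1.
  by move=> t0t; apply: speed_rate => //; [exact: lamp|exact: eqn].
(* By [spd], the left side is [L |y'|^(2 + e)]; by [tau_dtau] it equals [q tau tau' |g|^2]. *)
have diss t : t0 < t ->
    clock t0 q lam t * (`|ydot t| ^+ 2 / rate q lam t) <= - (q * dE t).
  move=> t0t; have ut := u0 _ t0t.
  have le := denergy_le xs (tau t0 q lam) y ip fconv fgrad dtp t0t.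
  rewrite -mulrN; apply: le_trans (_ : _ <= q * (tau t0 q lam t
    * dtau t0 q lam t * `|gradf (y t)| ^+ 2)) _; last first.
    by rewrite ler_pM2l// lerNr.
  rewrite ydotE// normrZ normrN (gtr0_norm (dtp _ t0t)).
  rewrite [leLHS]mulrA ler_pdivrMr//.
  rewrite le_eqVlt; apply/orP; left; apply/eqP.
  transitivity (clock t0 q lam t * dtau t0 q lam t
    * (dtau t0 q lam t * `|gradf (y t)| ^+ 2)); first by ring.
  by rewrite -tau_dtau//; ring.
have e0 : 0 <= e by rewrite divr_ge0 ?subr_ge0// mulr_ge0 ?ltW.
have [c [T [c0 t0T growth]]] : exists c T : R, [/\ 0 < c, t0 < T &
    forall t, T <= t -> c * t `^ (1 + e) <= clock t0 q lam t].
  (* If [e = 0], that is [p = 1], then [u = 1] and [clock t >= t - s >= t / 2] for [t >= 2 s]. *)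
  have [e1|e1] := eqVneq e 0.
    pose s := t0 + 1; exists 2^-1, (2 * s); split; [by []|by rewrite /s; lra|].
    have t0s : t0 < s by rewrite ltrDl.
    move=> t st; rewrite e1 addr0 powRr1; last by rewrite /s in st; lra.
    have : t - clock t0 q lam t <= s - clock t0 q lam s.
      apply: (@derive_le0_le _ (fun r => r - clock t0 q lam r)
          (fun r => 1 - rate q lam r)); first by rewrite /s in st *; lra.
        move=> r /andP[sr _]; have t0r := lt_le_trans t0s sr.
        exact: is_deriveB (is_derive_id r 1) (is_derive_clock q lamc lamp t0r).
      move=> r /andP[sr _]; have t0r := lt_le_trans t0s sr.
      have := spd _ (ltW t0r); rewrite e1 powRr0 => /(congr1 GRing.inv).
      by rewrite invrK invr1 => <-; rewrite subrr.
    have := clock_gt0 q lam t0p s; rewrite /s in st *; lra.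
  have e2 : 0 < e by rewrite lt_neqAle eq_sym e1.
  (* Here [|y'| = u^(-1/e)], so [|y'|^2 / u = u^(-(1 + 2/e))]; this is [u^(-1/al)] for
     [al = e / (e + 2)], and then [(1 + al) / (1 - al) = 1 + e]. *)
  apply: (@clock_growth _ _ _ _ t0p qp lamc lamp E dE (e / (e + 2))) => //.
  - rewrite divr_gt0//=; last by lra.
    by rewrite ltr_pdivrMr; lra.
  - by field; rewrite gt_eqF//; lra.
  - move=> t t0t; apply: le_trans (diss _ t0t).
    rewrite ler_pM2l ?clock_gt0//.
    have ut := u0 _ t0t.
    have -> : `|ydot t| = rate q lam t `^ (- e^-1).
      rewrite powRN -[LHS]powRr1// -(mulfV e1) powRrM spd ?(ltW t0t)//.
      by rewrite -powR_inv1 ?(ltW ut)// powRAC powR_inv1 ?powR_ge0.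
    rewrite -powR_mulrn ?powR_ge0// -powRrM -(powR_inv1 (ltW ut)) -powRD; last first.
      by rewrite (gt_eqF ut) implybT.
    rewrite le_eqVlt; apply/orP; left; apply/eqP; congr (_ `^ _).
    by field; rewrite e1 gt_eqF//; lra.
have kq : (1 + e) * q = 1 + q - p^-1.
  by rewrite /e; field; rewrite (gt_eqF pp) (gt_eqF qp).
pose c' := (q `^ q)^-1 * c `^ q.
have c'0 : 0 < c' by rewrite mulr_gt0 ?invr_gt0 ?powR_gt0.
have tauge t : T <= t -> c' * t `^ (1 + q - p^-1) <= tau t0 q lam t.
  by move=> Tt; rewrite -kq; apply: tau_ge_powR => //; [exact: ltW|exact: growth].
have kp : 0 < 1 + q - p^-1 by have := invf_le1 pp; rewrite p1; lra.
have tau_oo : tau t0 q lam @ +oo --> +oo.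
  apply/cvgryPge => A; near=> t.
  have Tt : T <= t by near: t; apply: nbhs_pinfty_ge; exact: num_real.
  have At : (`|A| / c') `^ (1 + q - p^-1)^-1 <= t.
    by near: t; apply: nbhs_pinfty_ge; exact: num_real.
  apply: le_trans (tauge _ Tt); rewrite mulrC -ler_pdivrMr//.
  apply: le_trans (_ : _ <= `|A| / c') _.
    by rewrite ler_pM2r ?invr_gt0// ler_norm.
  have A0 : 0 <= `|A| / c' by apply: divr_ge0 => //; exact: ltW.
  have AE : `|A| / c' =
      ((`|A| / c') `^ (1 + q - p^-1)^-1) `^ (1 + q - p^-1).
    by rewrite -powRrM mulVf ?gt_eqF// powRr1.
  by rewrite [leLHS]AE ge0_ler_powR ?nnegrE ?powR_ge0 ?(ltW kp).
(* The lower bound [tauge] converts [tau F -> 0] into the little-o rate; this serves both (i) and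
   (ii). *)
have small (F : R -> R) : (forall t, t0 < t -> 0 <= F t) ->
    (forall d, 0 < d -> \forall t \near +oo, tau t0 q lam t * F t <= d) ->
    littleo_pinfty F (fun t => t `^ (- (1 + q - p^-1))).
  move=> F0 hF d d0; near=> t.
  have Tt : T <= t by near: t; apply: nbhs_pinfty_ge; exact: num_real.
  have t0t := lt_le_trans t0T Tt.
  have tp := lt_trans t0p t0t.
  have h : tau t0 q lam t * F t <= d * c'.
    by near: t; apply: hF; rewrite mulr_gt0.
  rewrite ger0_norm ?F0// ger0_norm ?powR_ge0// powRN ler_pdivlMr ?powR_gt0//.
  rewrite -(ler_pM2r c'0); apply: le_trans h.
  have := ler_wpM2r (F0 _ t0t) (tauge _ Tt).
  by rewrite -mulrA [X in X <= _]mulrC (mulrC (_ `^ _)).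
split.
- apply: small; first by move=> t _; rewrite (argmin_inf xsmin) subr_ge0.
  rewrite (argmin_inf xsmin) => d d0.
  exact: (tau_value_small ip fconv fgrad xsmin dtauE dtp flow tau_oo).
- apply: small; first by [].
  move=> d d0.
  exact: (tau_gradient_small ip fconv fgrad xsmin glip dtauE dtp taup flow tau_oo).
- rewrite -/e (_ : 1 + q^-1 - (p * q)^-1 = 1 + e); last first.
    by rewrite /e; field; rewrite (gt_eqF pp) (gt_eqF qp).
  have e2 : 0 <= 2 + e by lra.
  have nydc : {within `[t0, +oo[, continuous (fun t => `|ydot t|)}.
    apply: (@within_continuous_comp _ _ _ `[t0, +oo[ ydot (fun z => `|z|)) => //.
    by move=> z _; exact: norm_continuous.
  have [b bT bmax] : exists2 b, b \in `[t0, T]%R &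
      forall t, t \in `[t0, T]%R -> `|ydot t| <= `|ydot b|.
    apply: (@EVT_max R (fun t => `|ydot t|)); first exact: ltW.
    apply: continuous_subspaceW nydc => t /=.
    by rewrite !in_itv /= => /andP[->].
  (* Beyond [T], [t^(1 + e) <= L / c], so [diss] bounds the integrand by [- (q / c) dE]. On
     [[t0, T]] it is bounded through the maximum of the speed, attained at [b]. *)
  apply: (@integral_dissipation_lty _ _ (fun t => q / c * E t)
    (fun t => q / c * dE t) t0 T (T `^ (1 + e) * `|ydot b| `^ (2 + e))).
  + exact: ltW.
  + apply: measurable_funM.
      by apply: measurable_funTS; exact: measurable_powR.
    apply: (measurableT_comp (measurable_powR _)).
    exact: subspace_continuous_measurable_fun.
  + by move=> t _; rewrite mulr_ge0 ?powR_ge0.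
  + move=> t /andP[t0t tT].
    rewrite ler_pM ?powR_ge0// ge0_ler_powR ?nnegrE//; try lra.
    by apply: bmax; rewrite in_itv /= t0t.
  + move=> t Tt; have t0t := lt_le_trans t0T Tt.
    exact: is_deriveZ (dEE _ t0t).
  + move=> t Tt; have t0t := lt_le_trans t0T Tt.
    have yc := is_derive_continuous (flow _ t0t).
    have gc : gradf (y s) @[s --> t] --> gradf (y t).
      by apply: continuous_cvg => //; exact: gcont.
    have fc := is_derive_continuous (is_derive_value ip fgrad flow t0t).
    have dc := dtau_continuous (q := q) t0p lamc lamp t0t.
    have tc := is_derive_continuous (dtauE _ t0t).
    rewrite /continuous_at; apply: cvgM; first exact: cvg_cst.
    apply: cvgB.
      apply: cvgM => //; apply: cvgB; first by apply: cvgB => //; exact: cvg_cst.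
      by apply: cvg_inner => //; apply: cvgB => //; exact: cvg_cst.
    apply: cvgM; first exact: cvgM.
    by rewrite expr2; under eq_cvg do rewrite expr2; apply: cvgM; apply: cvg_norm.
  + move=> t Tt; apply: mulr_ge0; first by rewrite divr_ge0 ?ltW.
    exact: E0 (lt_le_trans t0T Tt).
  + move=> t Tt; have t0t := lt_le_trans t0T Tt.
    rewrite [`|ydot t| `^ _]powRD; last by rewrite gt_eqF//; lra.
    rewrite spd ?(ltW t0t)// powR_mulrn//.
    have D0 : 0 <= `|ydot t| ^+ 2 / rate q lam t.
      by rewrite divr_ge0 ?sqr_ge0// ltW ?u0.
    rewrite -(ler_pM2l c0) [leLHS]mulrA [leRHS](_ : _ = - (q * dE t)).
      exact: le_trans (ler_wpM2r D0 (growth _ Tt)) (diss _ t0t).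
    by field; exact: lt0r_neq0.
- exact: (flow_weak_cvg ip fconv fgrad xsmin dtauE dtp flow tau_oo).
Unshelve. all: by end_near. Qed.
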